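(* Let $\alpha>0$, let $c=\alpha n$, let $\varepsilon>0$ be a sufficiently small constant and let $p=\frac{1+2\varepsilon}{n}$. Then with high probability $G_c(n,p)$ contains a rainbow cycle of length $\Omega\left(\varepsilon^2 n\right)$. That is, for every $\alpha>0$ there exist constants $\varepsilon_0,\kappa>0$ such that for every constant $0<\varepsilon<\varepsilon_0$, with high probability $G_{\alpha n}\left(n,\frac{1+2\varepsilon}{n}\right)$ contains a rainbow cycle of length at least $\kappa\varepsilon^2 n$.
   Context: For $c,n\in\mathbb{N}$ and $p\in(0,1)$, $G_c(n,p)$ is the random edge-coloured graph obtained by taking the Erdős–Rényi binomial random graph $G(n,p)$ on $n$ vertices and assigning to each edge a colour chosen independently and uniformly at random from a set of $c$ colours. A subgraph is rainbow if all of its edges receive different colours. ''With high probability'' means with probability tending to $1$ as $n\to\infty$. Floors and ceilings are ignored where they do not significantly affect the argument (so $c=\alpha n$ is understood up to rounding to an integer). *)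

(* Defs.v *)
From HB Require Import structures.
From mathcomp Require Import all_boot all_order all_algebra.
From mathcomp Require Import boolp classical_sets reals topology normedtype sequences.
Set Implicit Arguments.
Unset Strict Implicit.
Unset Printing Implicit Defensive.
Import Order.TTheory GRing.Theory Num.Theory.
Import numFieldNormedType.Exports.
Local Open Scope ring_scope.

Definition vpair (n : nat) := {e : {set 'I_n} | #|e| == 2%N}.

(* An edge-coloured simple graph on 'I_n with colours in 'I_c: a pair is sent
   to None if it is not an edge, and to Some k if it is an edge of colour k. *)
Definition cgraph (n c : nat) := {ffun vpair n -> option 'I_c}.

Section ColouredGraphs.
Variables n c : nat.
Implicit Types (G : cgraph n c) (x y : 'I_n) (s : seq 'I_n).

(* For x = y, [set x; y] is not a pair, insub fails and the result is None. *)
Definition colour G x y : option 'I_c :=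
  obind (fun e : vpair n => G e) (insub [set x; y]).

Definition adj G x y : bool := colour G x y != None.

(* s lists the vertices of a cycle in cyclic order, so that its edges are the
   pairs {x, next s x} for x in s, and its length is size s. *)
Definition is_cycle G s : bool :=
  [&& (2 < size s)%N, uniq s & cycle (adj G) s].

Definition rainbow_cycle G s : bool :=
  is_cycle G s && uniq [seq colour G x (next s x) | x <- s].

End ColouredGraphs.

Section RandomColouredGraph.
Variable R : realType.

(* The law of G_c(n,p): independently, each pair is a non-edge with probability
   1 - p and an edge of any given colour with probability p * (1 / c).
   It is a probability distribution when 0 <= p <= 1 and 0 < c. *)
Definition Gcnp_mass (n c : nat) (p : R) (G : cgraph n c) : R :=
  \prod_(e : vpair n) (if G e is Some _ then p * c%:R^-1 else 1 - p).

Definition Gcnp_prob (n c : nat) (p : R) (A : cgraph n c -> Prop) : R :=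
  \sum_(G : cgraph n c | `[< A G >]) Gcnp_mass p G.

Definition contains_rainbow_cycle (n c : nat) (l : R) (G : cgraph n c) : Prop :=
  exists2 s : seq 'I_n, rainbow_cycle G s & l <= (size s)%:R.

(* c n is alpha * n rounded, down or up, to an integer. *)
Definition rounds_linear (alpha : R) (c : nat -> nat) : Prop :=
  forall n : nat, `| (c n)%:R - alpha * n%:R | < 1.

End RandomColouredGraph.

(* Main.v *)
Require Import Defs.
From HB Require Import structures.
From mathcomp Require Import all_boot all_order all_algebra.
From mathcomp Require Import boolp classical_sets reals topology normedtype sequences.
From mathcomp Require Import exp.
From mathcomp Require Import fintype finset.
From mathcomp Require Import ring lra zify.
Set Implicit Arguments.
Unset Strict Implicit.
Unset Printing Implicit Defensive.
Import Order.TTheory GRing.Theory Num.Theory.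
Import numFieldNormedType.Exports.
Local Open Scope ring_scope.

(** Write p = p1 + p2 with p1 = (1 + eps) / n and p2 = eps / n.  The graph is
explored by a depth-first search that keeps a set S of finished vertices and a
stack l of vertices forming a rainbow path.  The search queries a pair {u, t},
where u is the top of the stack and t is unseen, with success probability p1
times the proportion of colours that do not occur on the path; after a success t
is pushed, and when u has no pair left to query it is moved to S.  The second
round p2 is never revealed by a failed query.

Let L be a small multiple of eps^2 n.  If the stack reaches L vertices, there
are of order L^2 pairs joining the first third of the path to the last third;
all but O(n) of them have kept their second round, so with high probability one
of them is an edge whose colour is not on the path ([chord_mass]).  It closes a
segment of the path into a rainbow cycle with more than L / 3 vertices.

If the stack stays below L until S has s = eps n / 4 vertices, then at that
moment every pair between S and the unseen vertices has been queried.  So at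
least s (n - s - L) queries were made, with at most s + L successes, since a
success puts a new vertex into S or l.  As the stack is short, each query
succeeded with probability at least p1 (1 - L / c), so at least
(1 + eps / 4) s successes were expected, more than s + L: this is exponentially
unlikely.

Both parts are carried out at once.  A query splits the law of a pair as a sum
of weights, one for failure and one for each new colour, and the whole measure
splits accordingly into product measures with smaller total mass
([pmass_split]).  The exponential estimate is a supermartingale bound: with i vertices
in S or l and j queried pairs, the mass of the graphs without a long rainbow
cycle is at most
  X^(s + L) a^(s (n - s - L)) / (X^i a^j) + (failure to close)
times the total mass, where X > 1 and a >= 1 - q (1 - 1 / X), q being a lower
bound for the success probability.  This is proved by induction on the amount of
search left ([search_mass]).  Taking X = 1 + eps / 8 at the start of the search
gives a failure probability O(1 / n) ([rainbow_cycle_rate]). *)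

(** * Products of weights on finite functions *)

Section ProductMeasure.
Variables (R : realFieldType) (E V : finType).
Implicit Types (f : E -> V -> R) (A : pred {ffun E -> V}).

(** The weights f e are not normalised: a pair that has been queried carries
only the part of its law that agrees with the answer, so that the mass of an
event already includes the probability of all the answers so far. *)
Definition pmass f A : R := \sum_(G | A G) \prod_e f e (G e).

Definition total_mass f : R := \prod_e \sum_v f e v.

Definition upd f e g : E -> V -> R := fun e' => if e' == e then g else f e'.

Lemma updE f e g : upd f e g e = g.
Proof. by rewrite /upd eqxx. Qed.

Lemma upd_neq f e g e' : e' != e -> upd f e g e' = f e'.
Proof. by rewrite /upd => /negbTE->. Qed.

Lemma upd_ge0 f e g : (forall e v, 0 <= f e v) -> (forall v, 0 <= g v) ->
  forall e' v, 0 <= upd f e g e' v.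
Proof. by move=> f0 g0 e' v; rewrite /upd; case: ifP. Qed.

Lemma pmass_total f : pmass f predT = total_mass f.
Proof. by rewrite /pmass /total_mass bigA_distr_bigA. Qed.

Lemma pmass_le f g A : (forall e v, 0 <= f e v) -> (forall e v, 0 <= g e v) ->
  (forall G, A G -> \prod_e f e (G e) <= \prod_e g e (G e)) ->
  pmass f A <= total_mass g.
Proof.
move=> f0 g0 fg; rewrite -pmass_total /pmass.
rewrite [leRHS](bigID A) /=; apply: ler_wpDr.
  by apply: sumr_ge0 => G _; apply: prodr_ge0.
exact: ler_sum.
Qed.

Lemma total_mass_upd f e g :
  \sum_v f e v = 1 -> total_mass (upd f e g) = (\sum_v g v) * total_mass f.
Proof.
move=> fe; rewrite /total_mass (bigD1 e) //= updE [X in _ = _ * X](bigD1 e) //= fe mul1r.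
congr (_ * _); apply: eq_bigr => e' ne; by rewrite upd_neq.
Qed.

(** Revealing the coordinate e: the product is linear in each of its factors, so
a decomposition of one weight decomposes the whole measure. *)
Lemma pmass_split (I : finType) (K : {set I}) (h : I -> V -> R) f e g A :
    (forall v, f e v = g v + \sum_(k in K) h k v) ->
  pmass f A = pmass (upd f e g) A + \sum_(k in K) pmass (upd f e (h k)) A.
Proof.
move=> fe; rewrite /pmass exchange_big /= -big_split /=; apply: eq_bigr => G _.
have H g' : \prod_e' upd f e g' e' (G e') = g' (G e) * \prod_(e' | e' != e) f e' (G e').
  rewrite (bigD1 e) //= updE; congr (_ * _).
  by apply: eq_bigr => e' ne; rewrite upd_neq.
rewrite H [X in _ + X](eq_bigr _ (fun k _ => H (h k))).
by rewrite -mulr_suml -mulrDl -fe (bigD1 e).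
Qed.

End ProductMeasure.

(** * Pairs, path colours and rainbow chords *)

Section Pairs.
Variables n c : nat.
Implicit Types (x y : 'I_n) (e : vpair n) (G : cgraph n c) (s l : seq 'I_n).

Lemma pair_ex x y : x != y -> exists e : vpair n, val e = [set x; y].
Proof.
move=> xy; have H : #|[set x; y]| == 2%N by rewrite cards2 xy.
by exists (Sub [set x; y] H).
Qed.

Lemma colourE G e x y : val e = [set x; y] -> colour G x y = G e.
Proof. by rewrite /colour => <-; rewrite valK. Qed.

Lemma colourC G x y : colour G x y = colour G y x.
Proof. by rewrite /colour setUC. Qed.

Definition between (A B : {set 'I_n}) : {set vpair n} :=
  [set e | [exists x in A, exists y in B, val e == [set x; y]]].

Lemma betweenP (A B : {set 'I_n}) e :
  reflect (exists x y, [/\ x \in A, y \in B & val e = [set x; y]])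
          (e \in between A B).
Proof.
rewrite inE; apply: (iffP existsP) => [[x /andP[xA /existsP[y /andP[yB /eqP]]]]|].
  by exists x, y.
move=> [x [y [xA yB ev]]]; exists x; rewrite xA.
by apply/existsP; exists y; rewrite yB ev eqxx.
Qed.

(** Disjointness makes x and y recoverable from the unordered pair. *)
Lemma card_between (A B : {set 'I_n}) :
  [disjoint A & B] -> #|between A B| = (#|A| * #|B|)%N.
Proof.
move=> dAB; rewrite -cardsX -(card_imset _ val_inj).
have inj : {in setX A B &, injective (fun z => [set z.1; z.2])}.
  move=> [x y] [x' y'] /setXP[/= xA yB] /setXP[/= xA' yB'] /= eqs.
  have ne u v : u \in A -> v \in B -> u != v.
    by move=> uA vB; apply: contraTneq vB => <-; rewrite (disjointFr dAB uA).
  have: x \in [set x'; y'] by rewrite -eqs set21.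
  rewrite !inE (negbTE (ne _ _ xA yB')) orbF => /eqP ->.
  have: y \in [set x'; y'] by rewrite -eqs set22.
  by rewrite !inE eq_sym (negbTE (ne _ _ xA' yB)) /= => /eqP ->.
rewrite -(card_in_imset inj); congr #|pred_of_set _|; apply/setP => E.
apply/imsetP/imsetP => [[e /betweenP[x [y [xA yB ev]]] ->]|[[x y] /setXP[/= xA yB] ->]].
  by exists (x, y); rewrite ?inE ?xA.
have xy : x != y by apply: contraTneq yB => <-; rewrite (disjointFr dAB xA).
have [e ev] := pair_ex xy.
by exists e; rewrite ?ev //; apply/betweenP; exists x, y.
Qed.

Definition path_colours G l := if l is x :: s then pairmap (colour G) x s else [::].

Lemma path_adj G x s : path (adj G) x s = all (predC1 None) (pairmap (colour G) x s).
Proof. by elim: s x => //= y s IH x; rewrite IH. Qed.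

Lemma cycle_colours G x s : uniq (x :: s) ->
  [seq colour G y (next (x :: s) y) | y <- x :: s] = pairmap (colour G) x (rcons s x).
Proof.
move=> u; apply: (@eq_from_nth _ None); first by rewrite size_map size_pairmap size_rcons.
move=> i; rewrite size_map => lti; rewrite (nth_map x) // (nth_pairmap x) ?size_rcons //.
rewrite next_nth mem_nth // index_uniq // nth_rcons -rcons_cons nth_rcons lti.
congr (colour G _ _); case: ltngtP => // h; first by rewrite nth_default // ltnW.
by rewrite h nth_default.
Qed.

(** The segment of the path from x to y inherits distinct colours, and the
closing edge has a colour that the path does not use. *)
Lemma rainbow_chord G l (ks : seq 'I_c) l1 x l2 y l3 k :
    l = l1 ++ x :: l2 ++ y :: l3 -> (0 < size l2)%N -> uniq l ->
    path_colours G l = [seq Some j | j <- ks] -> uniq ks ->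
    colour G x y = Some k -> k \notin ks ->
  rainbow_cycle G (x :: rcons l2 y).
Proof.
move=> -> l2gt0 ul pc uks cxy kks.
have {ul} us : uniq (x :: rcons l2 y).
  move: ul; rewrite cat_uniq -cat_cons -cat_rcons -rcons_cons cat_uniq.
  by case/and3P=> _ _ /andP[].
(* The colours of the segment are a contiguous part of ks. *)
have [ks' [ksub pcs]] : exists ks', subseq ks' ks /\
    pairmap (colour G) x (rcons l2 y) = [seq Some j | j <- ks'].
  have [a [b]] : exists a b, path_colours G (l1 ++ x :: l2 ++ y :: l3) =
      a ++ pairmap (colour G) x (rcons l2 y) ++ b.
    rewrite -(cat_rcons y); case: l1 {pc} => [|z l1] /=.
      by exists [::]; rewrite pairmap_cat; eexists.
    rewrite pairmap_cat /= pairmap_cat -cat_rcons.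
    by do 2!eexists.
  rewrite pc => eqk; exists (take (size (rcons l2 y)) (drop (size a) ks)); split.
    exact: subseq_trans (take_subseq _ _) (drop_subseq _ _).
  rewrite map_take map_drop eqk drop_size_cat // take_size_cat //.
  by rewrite size_pairmap.
have cols : pairmap (colour G) x (rcons (rcons l2 y) x) =
    rcons [seq Some j | j <- ks'] (Some k).
  by rewrite -cats1 pairmap_cat pcs last_rcons /= colourC cxy cats1.
apply/andP; split.
  apply/and3P; split => //; first by rewrite /= size_rcons.
  by rewrite /= path_adj cols all_rcons /= all_map; apply/allP.
rewrite cycle_colours // cols rcons_uniq map_inj_uniq
  ?(subseq_uniq ksub) //; last by move=> ? ? [].
rewrite andbT; apply: contra kks => /mapP[j jk [->]]; exact: mem_subseq jk.
Qed.

End Pairs.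

(** * Splitting the law of one pair *)

Section Exploration.
Variables (R : realFieldType) (n c : nat) (p p1 : R).
Hypotheses (p1_gt0 : 0 < p1) (p1p : p1 < p) (p_lt1 : p < 1) (c_gt0 : (0 < c)%N).
Implicit Types (e : vpair n) (f : vpair n -> option 'I_c -> R) (v : option 'I_c).
Implicit Types (k : 'I_c) (ks : seq 'I_c) (G : cgraph n c) (l : seq 'I_n).
Implicit Types (S : {set 'I_n}) (Q Cl : {set vpair n}) (A : pred (cgraph n c)).

Lemma sum_option (T : finType) (F : option T -> R) :
  \sum_v F v = F None + \sum_k F (Some k).
Proof.
rewrite (bigD1 None) //=; congr (_ + _); rewrite (reindex_omap Some id) /=; last by case.
by apply: eq_bigl => k; rewrite eqxx.
Qed.

Definition law v : R := if v is Some _ then p * c%:R^-1 else 1 - p.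

Definition fresh ks : {set 'I_c} := [set k | k \notin ks].

Lemma card_fresh ks (m : nat) : (size ks <= m)%N -> (c - m <= #|fresh ks|)%N.
Proof.
move=> sk; rewrite -[X in (X - _)%N](card_ord c) -(cardC [in ks]) leq_subLR.
apply: leq_add; first exact: leq_trans (card_size ks) sk.
by apply: eq_leq; apply: eq_card => k; rewrite !inE.
Qed.

Let c0 : 0 < c%:R :> R. Proof. by rewrite ltr0n. Qed.

Lemma sum_law : \sum_v law v = 1.
Proof.
rewrite sum_option /= sumr_const card_ord -[(p / c%:R) *+ c]mulr_natr divfK ?gt_eqF //.
by rewrite addrNK.
Qed.

Lemma law_gt0 v : 0 < law v.
Proof.
by case: v => [k|] /=; rewrite ?subr_gt0 // divr_gt0 // (lt_trans p1_gt0).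
Qed.

(** What a weight must retain for its pair to be usable as a chord: the whole
second round p - p1.  The bound on the total makes the conditional probability
of a colour at least its weight. *)
Definition unexposed (g : option 'I_c -> R) :=
  (forall k, (p - p1) / c%:R <= g (Some k)) /\ \sum_v g v <= 1.

(** A failed query may still hide an edge: one of a colour already on the path,
or one of the second round. *)
Definition missed ks v : R :=
  if v is Some k then (if k \in ks then p / c%:R else (p - p1) / c%:R) else 1 - p.

Definition hit k v : R := if v == Some k then p1 / c%:R else 0.

Lemma law_split ks v : law v = missed ks v + \sum_(k in fresh ks) hit k v.
Proof.
case: v => [k|] /=; last by rewrite big1 ?addr0.
case: ifPn => kks.
  rewrite big1 ?addr0 // => j; rewrite inE /hit => jks; case: eqP => // -[kj].
  by rewrite -kj kks in jks.
rewrite (bigD1 k) ?inE //= /hit eqxx big1 ?addr0 => [|j /andP[_ jk]].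
  by rewrite -mulrDl subrK.
by case: eqP => // -[kj]; rewrite kj eqxx in jk.
Qed.

Lemma sum_hit k : \sum_v hit k v = p1 / c%:R.
Proof.
by rewrite (bigD1 (Some k)) //= /hit eqxx big1 ?addr0 // => v /negbTE->.
Qed.

Lemma sum_missed ks : \sum_v missed ks v = 1 - p1 * #|fresh ks|%:R / c%:R.
Proof.
have := sum_law; under eq_bigr do rewrite (law_split ks).
rewrite big_split exchange_big /=; under [X in _ + X]eq_bigr do rewrite sum_hit.
by rewrite sumr_const -[(p1 / _) *+ _]mulr_natr mulrAC => /(canRL (addrK _)).
Qed.

Lemma missed_ge0 ks v : 0 <= missed ks v.
Proof.
case: v => [k|] /=; last by rewrite subr_ge0 ltW.
by case: ifP => _; rewrite divr_ge0 ?ltW // ?subr_gt0 // (lt_trans p1_gt0).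
Qed.

Lemma hit_ge0 k v : 0 <= hit k v.
Proof. by rewrite /hit; case: ifP => // _; rewrite divr_ge0 ?ltW. Qed.

Lemma missed_unexposed ks : unexposed (missed ks).
Proof.
split=> [k /=|]; last by rewrite sum_missed gerBl divr_ge0 ?mulr_ge0 // ltW.
by case: ifP => // _; rewrite ler_pM2r ?invr_gt0 // gerBl ltW.
Qed.

Lemma law_unexposed : unexposed law.
Proof.
split=> [k /=|]; last by rewrite sum_law.
by rewrite ler_pM2r ?invr_gt0 // gerBl ltW.
Qed.

(** * Closing a long rainbow path *)

Lemma avoid_prob (m : nat) : 0 <= 1 - (p - p1) * (c - m)%:R / c%:R <= 1.
Proof.
rewrite subr_ge0 gerBl -mulrA mulr_ge0 ?divr_ge0 ?subr_ge0 ?(ltW p1p) // andbT.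
have le1 : (c - m)%:R / c%:R <= 1 :> R.
  by rewrite ler_pdivrMr // mul1r ler_nat leq_subr.
have : (p - p1) * ((c - m)%:R / c%:R) <= (p - p1) * 1.
  by rewrite ler_pM2l // subr_gt0.
by move/le_trans; apply; rewrite mulr1 lerBlDr ltW // (lt_trans p_lt1) // ltrDl.
Qed.

(** Only pairs outside Cl are used as chords, and they are independent under the
product measure; each of them misses every new colour with conditional
probability at most 1 - (p - p1) (c - 3h) / c.  The path itself is present in
every graph of positive weight, by the hypothesis on the support of f. *)
Lemma chord_mass h l ks f Cl A :
    (0 < h)%N -> (h + h + h <= c)%N ->
    (forall e v, 0 <= f e v) -> (forall e, e \notin Cl -> unexposed (f e)) ->
    uniq l -> size l = (h + h + h)%N -> uniq ks -> (size ks <= size l)%N ->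
    (forall G, (forall e, f e (G e) != 0) -> path_colours G l = [seq Some k | k <- ks]) ->
    (forall G s, A G -> rainbow_cycle G s -> (size s <= h)%N) ->
  pmass f A <=
  (1 - (p - p1) * (c - (h + h + h))%:R / c%:R) ^+ (h * h - #|Cl|) * total_mass f.
Proof.
move=> h0 hc f0 fop ul sl uks sks fcol Acyc.
set l1 := take h l; set l2 := take h (drop h l); set l3 := drop h (drop h l).
have el : l = l1 ++ l2 ++ l3 by rewrite !cat_take_drop.
have s1 : size l1 = h by rewrite size_takel // sl; lia.
have s2 : size l2 = h by rewrite size_takel // size_drop sl; lia.
have s3 : size l3 = h by rewrite !size_drop sl; lia.
pose H := between [set x in l1] [set x in l3] :\: Cl.
have cardH : (h * h - #|Cl| <= #|H|)%N.
  have dis : [disjoint [set x in l1] & [set x in l3]].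
    rewrite disjoint_subset; apply/subsetP => x; rewrite !inE => x1; apply/negP => x3.
    move: ul; rewrite el cat_uniq => /and3P[_ /hasPn/(_ x)]; rewrite mem_cat x3 orbT.
    by move=> /(_ isT); rewrite x1.
  have card_seq s : uniq s -> #|[set x : 'I_n in s]| = size s.
    by rewrite cardsE => /card_uniqP.
  rewrite -[X in (X * _)%N]s1 -[X in (_ * X)%N]s3 -!card_seq ?take_uniq ?drop_uniq //.
  rewrite -card_between // leq_subLR.
  apply: leq_trans (subset_leq_card _) (leq_card_setU Cl H).
  by apply/subsetP => e eb; rewrite 2!inE eb andbT orbN.
(* A graph of A in the support of f has no new colour on any chord, so forbidding
   these values does not change its weight. *)
pose closing e v := (e \in H) && (if v is Some k then k \in fresh ks else false).
pose g e v := if closing e v then 0 else f e v.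
have g0 e v : 0 <= g e v by rewrite /g; case: ifP.
have fg : pmass f A <= total_mass g.
  apply: pmass_le => // G AG.
  have [/existsP[e /eqP fe]|/existsPn fG] := boolP [exists e, f e (G e) == 0].
    by rewrite (bigD1 e) //= fe mul0r prodr_ge0.
  rewrite le_eqVlt; apply/orP; left; apply/eqP; apply: eq_bigr => e _.
  rewrite /g; case: ifPn => // /andP[]; rewrite inE => /andP[_].
  case/betweenP => x [y []]; rewrite !inE => x1 y3 ev.
  case Ge: (G e) => [k|//]; rewrite inE => kks.
  have cxy : colour G x y = Some k by rewrite (colourE _ ev).
  have /splitPr : x \in l1 by [].
  move=> sp; case: sp el s1 => a b el s1.
  have /splitPr sp : y \in l3 by [].
  case: sp el s3 => a' b' el s3.
  have el' : l = a ++ x :: (b ++ l2 ++ a') ++ y :: b' by rewrite el -!catA.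
  have := rainbow_chord el' _ ul (fcol _ fG) uks cxy kks.
  rewrite !size_cat s2 addnC -addnA addn_gt0 h0 => /(_ isT)/(Acyc _ _ AG).
  rewrite /= size_rcons !size_cat s2 => toolong; exfalso; move: toolong; clear; lia.
apply: le_trans fg _; set q := 1 - _.
have Ffresh : (c - (h + h + h) <= #|fresh ks|)%N by apply: card_fresh; rewrite -sl.
have q01 : 0 <= q <= 1 := avoid_prob _.
have step e : \sum_v g e v <= (if e \in H then q else 1) * \sum_v f e v.
  rewrite /g /closing; case: ifPn => eH /=; last by rewrite mul1r.
  have /fop[fe1 fe2] : e \notin Cl by move: eH; rewrite inE => /andP[].
  have -> : \sum_v (if (if v is Some k then k \in fresh ks else false) then 0 else f e v) =
     \sum_v f e v - \sum_(k in fresh ks) f e (Some k).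
    rewrite !sum_option (bigID [in fresh ks]) /= big1 => [|i ->//].
    rewrite [in RHS](bigID [in fresh ks]) /= add0r addrCA addrAC subrr add0r.
    by congr (_ + _); apply: eq_bigr => i /negbTE->.
  have u0 : 0 <= (p - p1) / c%:R by rewrite divr_ge0 // subr_ge0 ltW.
  have : (1 - q) * \sum_v f e v <= \sum_(k in fresh ks) f e (Some k).
    rewrite /q subKr; apply: (@le_trans _ _ ((p - p1) / c%:R * #|fresh ks|%:R)); last first.
      rewrite mulr_natr -sumr_const; exact: ler_sum.
    apply: (@le_trans _ _ ((p - p1) / c%:R * (c - (h + h + h))%:R * 1)).
      by rewrite [X in X * _ <= _]mulrAC ler_wpM2l // mulr_ge0.
    by rewrite mulr1 ler_wpM2l // ler_nat.
  by rewrite mulrBl mul1r !lerBlDl addrC.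
rewrite /total_mass.
apply: le_trans (_ : \prod_e ((if e \in H then q else 1) * \sum_v f e v) <= _).
  by apply: ler_prod => e _; rewrite step sumr_ge0.
rewrite big_split /= -big_mkcond /= prodr_const ler_wpM2r //.
  by apply: prodr_ge0 => e _; apply: sumr_ge0.
by apply: ler_wiXn2l => //; case/andP: q01.
Qed.

(** * States of the depth-first search *)

(** S is the set of finished vertices, l the stack with its top first, ks the
colours of the path along l, Q the set of queried pairs and Cl the set of pairs
of successful queries.  The path is described through the support of f because
its edges are present in exactly those graphs.  Nothing says that a failed query
found no edge: the counting argument rests on the number of queries alone, which
ex_between bounds from below. *)
Record explored S l ks f Q Cl : Prop := Explored {
  ex_ge0 : forall e v, 0 <= f e v;
  ex_law : forall e, e \notin Q -> f e = law;
  ex_uniq : uniq l;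
  ex_disj : {in l, forall x, x \notin S};
  ex_rainbow : uniq ks;
  ex_size : (size ks <= size l)%N;
  ex_path : forall G, (forall e, f e (G e) != 0) ->
    path_colours G l = [seq Some k | k <- ks];
  ex_open : forall e, e \notin Cl -> unexposed (f e);
  ex_closed : (#|Cl| <= #|S| + size l)%N;
  ex_between : between S (~: (S :|: [set x in l])) \subset Q }.

Definition unseen S l : {set 'I_n} := ~: (S :|: [set x in l]).

Lemma card_unseen S l : uniq l -> {in l, forall x, x \notin S} ->
  (#|unseen S l| + (#|S| + size l) = n)%N.
Proof.
move=> ul dis; have := cardsC (S :|: [set x in l]); rewrite card_ord.
have -> : #|S :|: [set x in l]| = (#|S| + size l)%N.
  rewrite cardsU cardsE; have /card_uniqP -> := ul.
  suff -> : S :&: [set x in l] = set0 by rewrite cards0 subn0.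
  apply/setP => x; rewrite !inE; apply/andP => -[xS xl].
  by move: (dis _ xl); rewrite xS.
by rewrite addnC.
Qed.

Lemma card_queried S l ks f Q Cl : explored S l ks f Q Cl ->
  (#|S| * (n - (#|S| + size l)) <= #|Q|)%N.
Proof.
move=> ex; have := card_unseen (ex_uniq ex) (ex_disj ex) => cu.
have -> : (n - (#|S| + size l) = #|unseen S l|)%N by rewrite -[RHS](addnK (#|S| + size l)%N) cu.
rewrite -card_between; first exact: subset_leq_card (ex_between ex).
by rewrite disjoint_subset; apply/subsetP => x xS; rewrite !inE xS.
Qed.

(** When all pairs from the top u to unseen vertices have been queried, u may be
declared finished; nothing is revealed. *)
Lemma explored_pop S u l ks f Q Cl :
    explored S (u :: l) ks f Q Cl ->
    (forall e t, t \in unseen S (u :: l) -> val e = [set u; t] -> e \in Q) ->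
  explored (u |: S) l (behead ks) f Q Cl /\ #|u |: S| = #|S|.+1.
Proof.
move=> [f0 flaw ul dis uks sks fcol fop cl sub] uQ.
have uS : u \notin S by apply: dis; rewrite mem_head.
have cS : #|u |: S| = #|S|.+1 by rewrite cardsU1 uS.
split => //; have /= /andP[ul' ul''] := ul; split => //.
- move=> x xl; rewrite !inE negb_or dis ?inE ?xl ?orbT // andbT.
  by apply: contraNneq ul' => <-.
- by case: ks uks {sks fcol} => //= ? ? /andP[].
- by rewrite size_behead -subn1 leq_subLR add1n.
- move=> G /fcol pG; rewrite -behead_map -pG.
  by case: (l).
- by rewrite cS addSnnS.
- apply/subsetP => e /betweenP[x [y [xS yT ev]]].
  have yT' : y \in unseen S (u :: l).
    by move: yT; rewrite !inE !negb_or => /andP[/andP[-> ->] ->].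
  move: xS; rewrite !inE => /orP[/eqP xu|xS]; first by apply: (uQ e y) => //; rewrite -xu.
  by apply: (subsetP sub); apply/betweenP; exists x, y.
Qed.

Lemma explored_root S f Q Cl t ks :
    explored S [::] ks f Q Cl -> t \notin S -> explored S [:: t] [::] f Q Cl.
Proof.
move=> [f0 flaw ul dis uks sks fcol fop cl sub] tS; split => //.
- by move=> x; rewrite inE => /eqP->.
- by rewrite (leq_trans cl) // leq_add2l.
- apply: subset_trans sub; apply/subsetP => e /betweenP[x [y [xS yT ev]]].
  by apply/betweenP; exists x, y; split => //; move: yT; rewrite !inE !negb_or => /andP[->].
Qed.

Lemma explored_miss S u l ks f Q Cl e t :
    explored S (u :: l) ks f Q Cl -> e \notin Q ->
    t \in unseen S (u :: l) -> val e = [set u; t] ->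
  explored S (u :: l) ks (upd f e (missed ks)) (e |: Q) Cl.
Proof.
move=> [f0 flaw ul dis uks sks fcol fop cl sub] eQ tT ev; split => //.
- exact: upd_ge0 (missed_ge0 _).
- by move=> e'; rewrite !inE negb_or => /andP[ne /flaw]; rewrite upd_neq.
- move=> G fG; apply: fcol => e'; have := fG e'.
  by rewrite /upd; case: ifP => [/eqP-> _|_ //]; rewrite flaw // gt_eqF // law_gt0.
- by move=> e' /fop; rewrite /upd; case: ifP => // _ _; apply: missed_unexposed.
- by apply: subset_trans sub _; apply: subsetUr.
Qed.

Lemma explored_hit S u l ks f Q Cl e t k :
    explored S (u :: l) ks f Q Cl -> e \notin Q ->
    t \in unseen S (u :: l) -> val e = [set u; t] -> k \in fresh ks ->
  explored S (t :: u :: l) (k :: ks) (upd f e (hit k)) (e |: Q) (e |: Cl).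
Proof.
move=> [f0 flaw ul dis uks sks fcol fop cl sub] eQ tT ev; rewrite inE => kks.
have [tS tl] : t \notin S /\ t \notin u :: l.
  by move: tT; rewrite !inE negb_or => /andP[].
split => //.
- exact: upd_ge0 (hit_ge0 _).
- by move=> e'; rewrite !inE negb_or => /andP[ne /flaw]; rewrite upd_neq.
- by rewrite cons_uniq tl.
- by move=> x; rewrite inE => /orP[/eqP->//|/dis].
- by rewrite cons_uniq kks.
- move=> G fG; have pG : path_colours G (u :: l) = [seq Some j | j <- ks].
    apply: fcol => e'; have := fG e'.
    by rewrite /upd; case: ifP => [/eqP-> _|_ //]; rewrite flaw // gt_eqF // law_gt0.
  rewrite /= -pG /=; congr (_ :: _); rewrite colourC (colourE _ ev).
  by have := fG e; rewrite updE /hit; case: ifP => [/eqP //|_]; rewrite eqxx.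
- move=> e'; rewrite !inE negb_or => /andP[ne /fop]; by rewrite upd_neq.
- by rewrite cardsU1 /= addnS; apply: leq_add (leq_b1 _) cl.
- apply/subsetP => e' /betweenP[x [y [xS yT ev']]].
  rewrite inE (subsetP sub) ?orbT //; apply/betweenP; exists x, y; split => //.
  by move: yT; rewrite !inE !negb_or => /and3P[-> _ ->].
Qed.

(** * The search as a supermartingale *)

Section Search.
Variables (h s : nat) (X a : R) (A : pred (cgraph n c)).
Hypotheses (h_gt0 : (0 < h)%N) (h_le : (h + h + h <= c)%N) (s_le : (s <= n)%N).
Hypotheses (X_ge1 : 1 <= X) (a_gt0 : 0 < a) (a_le1 : a <= 1).
Hypothesis Xa : 1 - p1 * (c - (h + h + h))%:R / c%:R * (1 - X^-1) <= a.
Hypothesis A_short : forall G t, A G -> rainbow_cycle G t -> (size t <= h)%N.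

Definition chord_bound : R :=
  (1 - (p - p1) * (c - (h + h + h))%:R / c%:R) ^+ (h * h - (s + (h + h + h))).

(** The argument i counts the vertices in S or l, and j the queried pairs.  The
first term is at least 1 when S reaches s vertices with a short stack, because
then i <= s + 3h and j >= s (n - (s + 3h)). *)
Definition search_bound (i j : nat) : R :=
  X ^+ (s + (h + h + h)) * a ^+ (s * (n - (s + (h + h + h)))) / (X ^+ i * a ^+ j)
  + chord_bound.

Lemma chord_bound_ge0 : 0 <= chord_bound.
Proof. by rewrite exprn_ge0 //; case/andP: (avoid_prob (h + h + h)). Qed.

Let X_gt0 : 0 < X. Proof. exact: lt_le_trans X_ge1. Qed.

Let pot_ge0 i j : 0 <=
  X ^+ (s + (h + h + h)) * a ^+ (s * (n - (s + (h + h + h)))) / (X ^+ i * a ^+ j).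
Proof. by rewrite divr_ge0 // mulr_ge0 // exprn_ge0 // ltW. Qed.

Lemma search_bound_root i j : search_bound i.+1 j <= search_bound i j.
Proof.
rewrite /search_bound lerD2r ler_wpM2l ?mulr_ge0 ?exprn_ge0 ?(ltW X_gt0) ?(ltW a_gt0) //.
rewrite lef_pV2 ?posrE ?mulr_gt0 ?exprn_gt0 // ler_pM2r ?exprn_gt0 //.
by rewrite exprS ler_peMl // exprn_ge0 // ltW.
Qed.

(** The supermartingale property: a query has success probability p1 m / c with m
new colours, and a is at least the expectation of X^-1 raised to the number of
successes in one query. *)
Lemma search_bound_query i j (m : nat) : (c - (h + h + h) <= m)%N -> 
  (1 - p1 * m%:R / c%:R) * search_bound i j.+1
    + p1 * m%:R / c%:R * search_bound i.+1 j.+1 <= search_bound i j.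
Proof.
move=> mc; rewrite /search_bound !exprS; set K := X ^+ _ * a ^+ _; set w := p1 * _ / _.
set P := K / (X ^+ i * a ^+ j).
have -> : K / (X ^+ i * (a * a ^+ j)) = P / a.
  by rewrite /P mulrCA [a * _]mulrC invfM mulrA.
have -> : K / (X * X ^+ i * (a * a ^+ j)) = P / a / X.
  by rewrite /P mulrACA [X * a * _]mulrC [X * a]mulrC !invfM !mulrA.
have -> : (1 - w) * (P / a + chord_bound) + w * (P / a / X + chord_bound)
   = P * ((1 - w * (1 - X^-1)) / a) + chord_bound by ring.
rewrite lerD2r ler_piMr ?pot_ge0 // ler_pdivrMr // mul1r; apply: le_trans Xa.
rewrite lerD2l lerN2 ler_wpM2r ?subr_ge0 ?invf_le1 //.
by rewrite ler_pM2r ?invr_gt0 // ler_pM2l // ler_nat.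
Qed.

(** The quantity that decreases counts a vertex twice while it is unseen and once
on the stack, so pushing and popping both lower it, as does every query. *)
Lemma search_mass (m : nat) S l ks f Q Cl :
    (#|~: Q| + 2 * #|unseen S l| + size l < m)%N ->
    explored S l ks f Q Cl -> (#|S| <= s)%N -> (size l <= h + h + h)%N ->
  pmass f A <= search_bound (#|S| + size l) #|Q| * total_mass f.
Proof.
elim: m S l ks f Q Cl => [//|m IH] S l ks f Q Cl hm ex Ss lh.
have tot0 : 0 <= total_mass f.
  by apply: prodr_ge0 => e _; apply: sumr_ge0 => v _; apply: ex_ge0 ex e v.
(* The stack is long enough to be closed. *)
have [lh'|lh'] := eqVneq (size l) (h + h + h)%N.
  apply: le_trans (_ : chord_bound * total_mass f <= _); last first.
    by rewrite ler_wpM2r // ler_wpDl // pot_ge0.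
  have [f0 flaw ul dis uks sks fcol fop cl sub] := ex.
  apply: le_trans (chord_mass h_gt0 h_le f0 fop ul lh' uks sks fcol A_short) _.
  rewrite ler_wpM2r //; case/andP: (avoid_prob (h + h + h)) => q0 q1.
  apply: ler_wiXn2l => //; rewrite leq_sub2l // (leq_trans cl) // lh' leq_add2r //.
(* Enough vertices are finished: too few successes for so many queries. *)
have [Ss'|Ss'] := eqVneq #|S| s.
  have f0 := ex_ge0 ex.
  apply: le_trans (_ : total_mass f <= _); first exact: pmass_le.
  rewrite ler_peMl // ler_wpDr ?chord_bound_ge0 //.
  rewrite ler_pdivlMr ?mulr_gt0 ?exprn_gt0 // mul1r
    ler_pM ?exprn_ge0 ?(ltW X_gt0) ?(ltW a_gt0) //.
    by rewrite ler_weXn2l // Ss' leq_add2l.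
  rewrite ler_wiXn2l ?(ltW a_gt0) //; apply: leq_trans (card_queried ex).
  by rewrite Ss' leq_mul2l leq_sub2l ?orbT // leq_add2l.
have {}Ss : (#|S| < s)%N by rewrite ltn_neqAle Ss' Ss.
have {}lh : (size l < h + h + h)%N by rewrite ltn_neqAle lh' lh.
have cu := card_unseen (ex_uniq ex) (ex_disj ex).
case: l => [|u l] in hm ex lh lh' cu *.
  (* Empty stack: restart from an unseen vertex, without any query. *)
  have /card_gt0P[t tT] : (0 < #|unseen S [::]|)%N.
    move: cu Ss s_le; rewrite /= addn0; clear; lia.
  have tS : t \notin S by move: tT; rewrite !inE orbF.
  have ex' := explored_root ex tS.
  have cu' := card_unseen (ex_uniq ex') (ex_disj ex').
  apply: le_trans (IH _ _ _ _ _ _ _ ex' (ltnW Ss) _) _ => //.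
  - move: hm cu cu' => /=; clear; lia.
  - by rewrite ler_wpM2r //= addn1 addn0 search_bound_root.
have [/existsP[t /existsP[e /and3P[tT /eqP ev eQ]]]|noq] :=
    boolP [exists t, exists e,
      [&& t \in unseen S (u :: l), val e == [set u; t] & e \notin Q]].
  have fe : f e = law := ex_law ex eQ.
  have split v : f e v = missed ks v + \sum_(k in fresh ks) hit k v.
    by rewrite fe (law_split ks).
  have fe1 : \sum_v f e v = 1 by rewrite fe sum_law.
  have cQ : #|e |: Q| = #|Q|.+1 by rewrite cardsU1 eQ.
  have cQ' : #|~: (e |: Q)|.+1 = #|~: Q|.
    by apply: (@addnI #|Q|); rewrite addnS -addSn -cQ !cardsC.
  have exm := explored_miss ex eQ tT ev.
  rewrite (pmass_split _ split).
  have miss : pmass (upd f e (missed ks)) A <=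
     search_bound (#|S| + size (u :: l)) #|Q|.+1 *
       ((1 - p1 * #|fresh ks|%:R / c%:R) * total_mass f).
    rewrite -sum_missed -(total_mass_upd _ fe1) -cQ.
    apply: (IH _ _ _ _ _ _ _ exm) => //; last exact: ltnW.
    + by move: hm; rewrite -cQ' !addSn ltnS.
    + exact: ltnW.
  have hits k : k \in fresh ks -> pmass (upd f e (hit k)) A <=
     search_bound (#|S| + size (u :: l)).+1 #|Q|.+1 * (p1 / c%:R * total_mass f).
    move=> kks; have exh := explored_hit ex eQ tT ev kks.
    have cu' := card_unseen (ex_uniq exh) (ex_disj exh).
    rewrite -(sum_hit k) -(total_mass_upd _ fe1) -cQ -addnS.
    apply: (IH _ _ _ _ _ _ _ exh) => //.
    + move: hm; rewrite -cQ' !addSn ltnS; apply: leq_ltn_trans.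
      by rewrite -!addnA leq_add2l; move: cu cu' => /=; clear; lia.
    + exact: ltnW.
  have hitsum := ler_sum (index_enum _) hits.
  apply: le_trans (lerD miss hitsum) _.
  rewrite sumr_const -mulr_natr.
  have fr : (c - (h + h + h) <= #|fresh ks|)%N.
    by apply: card_fresh; rewrite (leq_trans (ex_size ex)) // ltnW.
  have := ler_wpM2r tot0 (search_bound_query (#|S| + size (u :: l)) #|Q| fr).
  apply: le_trans; rewrite le_eqVlt; apply/orP; left; apply/eqP; ring.
have uQ e t : t \in unseen S (u :: l) -> val e = [set u; t] -> e \in Q.
  move=> tT ev; apply: contraNT noq => eQ.
  by apply/existsP; exists t; apply/existsP; exists e; rewrite tT ev eqxx.
have [ex' cS] := explored_pop ex uQ.
have cu' := card_unseen (ex_uniq ex') (ex_disj ex').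
rewrite /= addnS -addSn -cS; apply: (IH _ _ _ _ _ _ _ ex').
- move: hm; rewrite /= addnS ltnS; apply: leq_trans.
  by rewrite ltnS leq_add2r leq_add2l; move: cu cu'; rewrite cS /=; clear; lia.
- by rewrite cS.
- by move: lh => /=; clear; lia.
Qed.
End Search.

End Exploration.

(** * From the search to a failure probability *)

Lemma Gcnp_prob_compl (R : realType) (n c : nat) (p : R) (P : cgraph n c -> Prop) :
  (0 < c)%N ->
  1 - Gcnp_prob p P = pmass (fun _ => @law R c p) (fun G => ~~ `[< P G >]).
Proof.
move=> c0; set f := fun _ : vpair n => @law R c p.
have e1 : pmass f predT = 1.
  by rewrite pmass_total /total_mass big1 // => e _; apply: sum_law.
rewrite -e1 /pmass /= (bigID (fun G => `[< P G >])) /= addrAC.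
by rewrite [X in X - _](_ : _ = Gcnp_prob p P) // subrr add0r.
Qed.

Lemma rainbow_cycle_prob (R : realType) (n c : nat) (p p1 : R) (h s : nat) (X a len : R) :
    0 < p1 -> p1 < p -> p < 1 -> (0 < c)%N ->
    (0 < h)%N -> (h + h + h <= c)%N -> (s <= n)%N ->
    1 <= X -> 0 < a -> a <= 1 ->
    1 - p1 * (c - (h + h + h))%:R / c%:R * (1 - X^-1) <= a ->
    len <= h.+1%:R ->
  0 <= 1 - Gcnp_prob p (@contains_rainbow_cycle R n c len)
    <= search_bound n c p p1 h s X a 0 0.
Proof.
move=> p10 p1p p1' c0 h0 hc sn X1 a0 a1 Xa lenh.
have p0 : 0 < p := lt_trans p10 p1p.
rewrite Gcnp_prob_compl //; set f := fun _ : vpair n => @law R c p.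
set A : pred (cgraph n c) := fun G => ~~ _.
have f0 e v : 0 <= f e v by exact: ltW (law_gt0 p10 p1p p1' c0 v).
apply/andP; split; first by apply: sumr_ge0 => G _; apply: prodr_ge0.
have total1 : total_mass f = 1 by apply: big1 => e _; apply: sum_law.
have Ashort (G : cgraph n c) (t : seq 'I_n) : A G -> rainbow_cycle G t -> (size t <= h)%N.
  move=> /asboolPn AG tc; rewrite leqNgt; apply/negP => ht; apply: AG.
  by exists t => //; apply: le_trans lenh _; rewrite ler_nat.
have init : explored p p1 finset.set0 [::] [::] f finset.set0 finset.set0.
  split => //.
  - by move=> e _; apply: law_unexposed.
  - by rewrite finset.cards0.
  - apply/subsetP => e /betweenP[x [y [x0 _ _]]].
    by move: x0; rewrite !finset.in_set0.
have := search_mass p10 p1p p1' c0 h0 hc sn X1 a0 a1 Xa Ashort (ltnSn _) init.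
by rewrite !finset.cards0 total1 mulr1; apply.
Qed.

(** * Asymptotics *)

Lemma powers_le_expR (R : realType) (i j : nat) (x w : R) :
  0 <= x -> w <= 1 -> (1 + x) ^+ i * (1 - w) ^+ j <= expR (i%:R * x - j%:R * w).
Proof.
move=> x0 w1; rewrite -mulrN expRD !expRM_natl.
have x1 : 0 <= 1 + x by rewrite addr_ge0.
have w1' : 0 <= 1 - w by rewrite subr_ge0.
by rewrite ler_pM ?exprn_ge0 // lerXn2r ?nnegrE ?expR_ge0 // expR_ge1Dx.
Qed.

(** Exponential decay is only used to beat a multiple of 1 / n. *)
Lemma expR_le_inv (R : realType) (x y : R) : 0 < y -> x <= - y -> expR x <= y^-1.
Proof.
move=> y0 xy; apply: (@le_trans _ _ (expR (- y))); first by rewrite ler_expR.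
rewrite expRN lef_pV2 ?posrE ?expR_gt0 //.
by apply: le_trans (expR_ge1Dx y); rewrite lerDr.
Qed.

(** To first order the right-hand side is 1 + (1 - 0.26 - 0.125) e; the margin over
1 + e / 4 absorbs the higher order terms for e < 1 / 4. *)
Lemma drift_margin (R : realFieldType) (e : R) : 0 < e -> e < 1 / 4 ->
  1 + e / 4 <= (1 - 26 / 100 * e) * ((1 + e) * (1 - 3 / 100 * e ^+ 2) * (1 - e / 8)).
Proof.
move=> e0 e1; rewrite expr2.
have ee : 0 <= e * (1 / 4 - e) by rewrite mulr_ge0 //; lra.
have e2 : 0 <= e * e by rewrite mulr_ge0 // ltW.
have f1 : 1 + 675 / 1000 * e <= (1 - 26 / 100 * e) * (1 + e) by lra.
have f2 : 1 - 3 / 400 * e <= 1 - 3 / 100 * (e * e) by lra.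
have f3 : 1 - 1325 / 10000 * e <= (1 - 3 / 100 * (e * e)) * (1 - e / 8).
  apply: (@le_trans _ _ ((1 - 3 / 400 * e) * (1 - e / 8))); first lra.
  by rewrite ler_wpM2r //; lra.
apply: (@le_trans _ _ ((1 + 675 / 1000 * e) * (1 - 1325 / 10000 * e))); first lra.
rewrite -[X in _ <= _ * X]mulrA [X in _ <= X]mulrA.
by apply: ler_pM => //; lra.
Qed.

(** Here S is the number of finished vertices, L the length of the stack, 1 + x
the base X and q the success probability of a query.  At most
S + L <= (1 + 0.12 eps) S queries succeeded, while (1 + eps / 4) S successes were
due; the difference 0.13 eps S is multiplied by x = eps / 8. *)
Lemma search_exponent (R : realFieldType) (eps N S L x q : R) :
    0 < eps -> eps < 1 / 4 -> 0 < N -> eps * N / 8 <= S -> S <= eps * N / 4 ->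
    0 <= L -> L <= 3 * eps ^+ 2 * N / 200 -> x = eps / 8 ->
    (1 + eps) * (1 - 3 / 100 * eps ^+ 2) / N <= q ->
  (S + L) * x - S * (N - (S + L)) * (q * (1 - (1 + x)^-1)) <= - (eps ^+ 3 * N / 512).
Proof.
move=> e0 e1 N0 S1 S2 L0 L1 xE qE.
have x0 : 0 < x by rewrite xE; lra.
have inv : x * (1 - x) <= 1 - (1 + x)^-1.
  have -> : 1 - (1 + x)^-1 = x * (1 + x)^-1 by field; lra.
  rewrite ler_wpM2l ?(ltW x0) // -[leRHS]mul1r ler_pdivlMr; nra.
have S0 : 0 < S by apply: lt_le_trans S1; rewrite divr_gt0 // mulr_gt0.
have eN : 0 < eps * N by rewrite mulr_gt0.
have LeN : L <= 3 / 800 * (eps * N).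
  apply: le_trans L1 _; rewrite expr2; nra.
have L2 : L <= 12 / 100 * eps * S.
  apply: le_trans L1 _; rewrite expr2; nra.
have SL : N * (1 - 26 / 100 * eps) <= N - (S + L) by lra.
have rate : 1 + eps / 4 <=
    (1 - 26 / 100 * eps) * ((1 + eps) * (1 - 3 / 100 * eps ^+ 2) * (1 - x)).
  by rewrite xE; apply: drift_margin.
have key : x * (1 + eps / 4) <= (N - (S + L)) * (q * (1 - (1 + x)^-1)).
  have qx : (1 + eps) * (1 - 3 / 100 * eps ^+ 2) / N * (x * (1 - x)) <= q * (1 - (1 + x)^-1).
    apply: ler_pM => //.
      rewrite divr_ge0 ?(ltW N0) // mulr_ge0 //; first lra.
      rewrite expr2; nra.
    by rewrite xE; nra.
  apply: (@le_trans _ _ (N * (1 - 26 / 100 * eps) *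
    ((1 + eps) * (1 - 3 / 100 * eps ^+ 2) / N * (x * (1 - x))))).
    have -> : N * (1 - 26 / 100 * eps) *
        ((1 + eps) * (1 - 3 / 100 * eps ^+ 2) / N * (x * (1 - x)))
      = x * ((1 - 26 / 100 * eps) * ((1 + eps) * (1 - 3 / 100 * eps ^+ 2) * (1 - x))).
      by field; lra.
    by rewrite ler_wpM2l // ltW.
  apply: ler_pM => //; first by rewrite mulr_ge0 ?(ltW N0) //; lra.
  apply: mulr_ge0; last by rewrite xE; nra.
  by apply: divr_ge0; [apply: mulr_ge0; [lra|rewrite expr2; nra]|exact: ltW].
have := ler_wpM2l (ltW S0) key; rewrite mulrA => kS.
have SLx : (S + L) * x <= (S + 12 / 100 * eps * S) * x by rewrite ler_wpM2r ?lerD2l // ltW.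
apply: (@le_trans _ _ (- (13 / 100 * eps * S * x))); first by rewrite -mulrA in kS *; lra.
have eS : eps * S * x >= eps ^+ 3 * N / 64.
  have -> : eps ^+ 3 * N / 64 = eps * (eps * N / 8) * (eps / 8) by field.
  by rewrite xE ler_wpM2r ?ler_wpM2l ?divr_ge0 ?(ltW e0).
have : 0 <= eps ^+ 3 * N by rewrite mulr_ge0 ?exprn_ge0 // ltW.
lra.
Qed.

Lemma power_le_inv (R : realType) (u y : R) (j : nat) :
  u <= 1 -> 0 < y -> y <= j%:R * u -> (1 - u) ^+ j <= y^-1.
Proof.
move=> u1 y0 yj; have := powers_le_expR 0 j (lexx 0) u1.
rewrite expr0 mul1r mul0r sub0r => /le_trans; apply.
by apply: expR_le_inv; rewrite // lerN2.
Qed.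

Lemma natrB_ge (R : realFieldType) (i j : nat) : i%:R - j%:R <= (i - j)%N%:R :> R.
Proof. by rewrite lerBlDr -natrD ler_nat addnC -leq_subLR. Qed.

(** A path of 3h vertices with h about beta eps^2 n is sought, s being about
eps n / 4.  The assumption beta <= alpha / 200 keeps the proportion of colours
used by the path below 3 / 100 eps^2, so it does not spoil the drift eps of the
search; beta <= 1 / 200 keeps 3h negligible compared with eps s. *)
Lemma rainbow_cycle_rate (R : realType) (alpha beta eps : R) (n c : nat) :
    0 < alpha -> 0 < beta -> beta <= 1 / 200 -> beta <= alpha / 200 ->
    0 < eps -> eps < 1 / 4 -> `|c%:R - alpha * n%:R| < 1 ->
    4 < n%:R :> R -> 2 < alpha * n%:R -> 8 < eps * n%:R ->
    2 < beta * eps ^+ 2 * n%:R -> 8 < beta ^+ 2 * eps ^+ 4 * n%:R ->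
  0 <= 1 - Gcnp_prob ((1 + 2 * eps) / n%:R)
             (@contains_rainbow_cycle R n c (beta * eps ^+ 2 * n%:R))
    <= (512 / eps ^+ 3 + 16 / (beta ^+ 2 * eps ^+ 5)) / n%:R.
Proof.
set N : R := n%:R => alpha0 beta0 beta1 betaa eps0 eps1.
set C : R := c%:R; rewrite ltr_distl => /andP[C1 _] N4 Na Ns Nh Nb.
have N0 : 0 < N by apply: lt_trans N4.
have /truncn_itv/andP[H1 H2] : 0 <= beta * eps ^+ 2 * N by apply: ltW; apply: lt_trans Nh.
have /truncn_itv/andP[S1 S2] : 0 <= eps * N / 4 by rewrite divr_ge0 // mulr_ge0 // ltW.
move: H1 H2 S1 S2; set h := Num.trunc _; set s := Num.trunc _ => H1 H2 S1 S2.
have len := ltW H2.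
rewrite -[ltRHS]natr1 in H2; rewrite -[ltRHS]natr1 in S2.
have C2 : alpha * N / 2 <= C by clear -C1 Na; lra.
have C0 : 0 < C by apply: lt_le_trans C2; rewrite divr_gt0 // mulr_gt0.
have c0 : (0 < c)%N by rewrite -(ltr0n R).
have h0 : (0 < h)%N by rewrite -(ltr0n R); clear -H2 Nh; lra.
have LE : (h + h + h)%N%:R = 3 * h%:R :> R by rewrite !natrD; ring.
have e2N : 0 <= eps ^+ 2 * N by rewrite mulr_ge0 ?exprn_ge0 // ltW.
have L1 : (h + h + h)%N%:R <= 3 * eps ^+ 2 * N / 200.
  rewrite LE; have : beta * (eps ^+ 2 * N) <= 1 / 200 * (eps ^+ 2 * N) by rewrite ler_wpM2r.
  by move: H1; rewrite mulrA; clear; lra.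
have L2 : (h + h + h)%N%:R <= 3 / 100 * eps ^+ 2 * C.
  have : beta * (eps ^+ 2 * N) <= alpha / 200 * (eps ^+ 2 * N) by rewrite ler_wpM2r.
  have : eps ^+ 2 * (alpha * N / 2) <= eps ^+ 2 * C by rewrite ler_wpM2l // exprn_ge0 // ltW.
  by move: H1; rewrite LE; clear; lra.
have eps2 : eps ^+ 2 <= 1 by rewrite expr_le1 // ltW // (lt_trans eps1) //; clear; lra.
have L3 : (h + h + h)%N%:R <= C / 2.
  apply: le_trans L2 _; have : eps ^+ 2 * C <= 1 * C by rewrite ler_pM2r.
  by clear -C0; lra.
have hc3 : (h + h + h <= c)%N.
  by rewrite -(ler_nat R) (le_trans L3) // -/C; clear -C0; lra.
have NS' : s%:R + (h + h + h)%:R <= N.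
  have : eps ^+ 2 * N <= 1 * N by rewrite ler_pM2r.
  have : eps * N <= 1 / 4 * N by rewrite ler_pM2r // ltW.
  by clear -S1 L1 N0; lra.
have NS : (s + (h + h + h) <= n)%N by rewrite -(ler_nat R) natrD.
pose rho : R := (c - (h + h + h))%:R / C.
have rhoE : rho = 1 - (h + h + h)%:R / C.
  by rewrite /rho natrB // -/C mulrBl divff // gt_eqF.
have rho1 : rho <= 1 by rewrite rhoE gerBl divr_ge0 // ltW.
have rho2 : 1 / 2 <= rho.
  by rewrite rhoE lerBrDr -lerBrDl ler_pdivrMr //; clear -L3; lra.
have rho0 : 0 <= rho by apply: le_trans rho2; rewrite divr_ge0.
have rho3 : 1 - 3 / 100 * eps ^+ 2 <= rho by rewrite rhoE lerD2l lerN2 ler_pdivrMr.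
pose x := eps / 8; pose q := (1 + eps) / N * rho.
have x0 : 0 < x by rewrite divr_gt0.
have X1 : 1 <= 1 + x by rewrite lerDl ltW.
have /andP[iX0 iX1] : 0 <= 1 - (1 + x)^-1 < 1.
  by rewrite subr_ge0 invf_le1 ?(lt_le_trans _ X1) // X1 gtrBl invr_gt0 (lt_le_trans _ X1).
have p10 : 0 < (1 + eps) / N by rewrite divr_gt0 // addr_gt0.
have p1p : (1 + eps) / N < (1 + 2 * eps) / N.
  by rewrite ltr_pM2r ?invr_gt0 //; clear -eps0; lra.
have p1 : (1 + 2 * eps) / N < 1 by rewrite ltr_pdivrMr //; clear -eps1 N4; lra.
have q0 : 0 <= q by rewrite mulr_ge0 // ltW.
have q1 : q <= 1 by rewrite mulr_ile1 // ltW // (lt_trans p1p).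
have w0 : 0 <= q * (1 - (1 + x)^-1) by rewrite mulr_ge0.
have w1 : q * (1 - (1 + x)^-1) < 1 by apply: le_lt_trans iX1; rewrite ler_piMl.
have a0 : 0 < 1 - q * (1 - (1 + x)^-1) by rewrite subr_gt0.
have a1 : 1 - q * (1 - (1 + x)^-1) <= 1 by rewrite gerBl.
have Xa : 1 - (1 + eps) / N * (c - (h + h + h))%:R / c%:R * (1 - (1 + x)^-1)
    <= 1 - q * (1 - (1 + x)^-1) by rewrite /q /rho mulrA.
have sn : (s <= n)%N by apply: leq_trans NS; apply: leq_addr.
have /andP[-> B2] := rainbow_cycle_prob p10 p1p p1 c0 h0 hc3 sn X1 a0 a1 Xa len.
apply: le_trans B2 _.
(* The search does not find a long path. *)
have T1 : (1 + x) ^+ (s + (h + h + h)) *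
    (1 - q * (1 - (1 + x)^-1)) ^+ (s * (n - (s + (h + h + h)))) 
    <= (eps ^+ 3 * N / 512)^-1.
  apply: le_trans (powers_le_expR _ _ (ltW x0) (ltW w1)) _.
  apply: expR_le_inv; first by rewrite divr_gt0 // mulr_gt0 // exprn_gt0.
  rewrite natrM natrB // !(natrD _ s) -/N; apply: (@search_exponent R eps) => //.
    by clear -S2 Ns; lra.
  by rewrite /q mulrAC ler_pM2l.
(* The long path is not closed by a chord. *)
have T2 : chord_bound c ((1 + 2 * eps) / N) ((1 + eps) / N) h s <=
     (beta ^+ 2 * eps ^+ 5 * N / 16)^-1.
  have uE : ((1 + 2 * eps) / N - (1 + eps) / N) * (c - (h + h + h))%:R / c%:R
      = eps / N * rho.
    by rewrite -mulrA -mulrBl; congr (_ / _ * _); ring.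
  rewrite /chord_bound uE; apply: power_le_inv.
  - rewrite mulr_ile1 // ?divr_ge0 ?ltW // ltr_pdivrMr // mul1r.
    by rewrite (lt_trans eps1) //; clear -N4; lra.
  - by rewrite divr_gt0 // !mulr_gt0 ?exprn_gt0.
  have hN : beta ^+ 2 * eps ^+ 4 * N ^+ 2 / 8 <= (h * h - (s + (h + h + h)))%N%:R.
    apply: le_trans (natrB_ge R _ _); rewrite natrM natrD.
    have hH : (beta * eps ^+ 2 * N / 2) * (beta * eps ^+ 2 * N / 2) <= h%:R * h%:R.
      have hh : beta * eps ^+ 2 * N / 2 <= h%:R by clear -H2 Nh; lra.
      by rewrite ler_pM // divr_ge0 // (le_trans _ (ltW Nh)).
    have : 8 * N <= beta ^+ 2 * eps ^+ 4 * N * N by rewrite ler_pM2r // ltW.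
    by move: hH; clear -NS'; lra.
  have -> : beta ^+ 2 * eps ^+ 5 * N / 16 =
      beta ^+ 2 * eps ^+ 4 * N ^+ 2 / 8 * (eps / N * (1 / 2)).
    by field; rewrite gt_eqF.
  have eN : 0 < eps / N by rewrite divr_gt0.
  apply: ler_pM => //; last by rewrite ler_pM2l.
    by rewrite divr_ge0 // !mulr_ge0 ?exprn_ge0 // ltW.
  by rewrite mulr_ge0 ?(ltW eN) // divr_ge0.
rewrite /search_bound !expr0 mulr1 invr1 mulr1; apply: le_trans (lerD T1 T2) _.
by rewrite le_eqVlt; apply/orP; left; apply/eqP; field; rewrite !gt_eqF.
Qed.

Local Open Scope classical_set_scope.
Local Open Scope ring_scope.

Theorem theorem4p3 (R : realType) (alpha : R) (halpha : 0 < alpha) :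
  exists eps0 kappa : R,
    [/\ 0 < eps0, 0 < kappa &
      forall eps : R, 0 < eps -> eps < eps0 ->
      forall c : nat -> nat, rounds_linear alpha c ->
        (fun n : nat =>
           Gcnp_prob ((1 + 2 * eps) / n%:R)
             (@contains_rainbow_cycle R n (c n) (kappa * eps ^+ 2 * n%:R)))
          @ \oo --> (1 : R)].
Proof.
pose beta := Num.min 1 alpha / 200.
have beta0 : 0 < beta by rewrite divr_gt0 // lt_min ltr01.
have beta1 : beta <= 1 / 200 by rewrite ler_pM2r ?invr_gt0 // ge_min lexx.
have betaa : beta <= alpha / 200 by rewrite ler_pM2r ?invr_gt0 // ge_min lexx orbT.
exists (1 / 4), beta; split => //; first by rewrite divr_gt0.
move=> eps eps0 eps1 c hc.
apply/cvgrPdist_lt => r r0.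
have large (k b : R) : 0 < k -> \forall n \near \oo, b < k * n%:R.
  move=> k0; near=> n; rewrite mulrC -ltr_pdivrMr //.
  by near: n; exact: nbhs_infty_gtr.
near=> n.
have n4 : 4 < n%:R :> R by near: n; exact: nbhs_infty_gtr.
have n0 : 0 < n%:R :> R by apply: lt_trans n4.
have na : 2 < alpha * n%:R by near: n; exact: large.
have ne : 8 < eps * n%:R by near: n; exact: large.
have nb : 2 < beta * eps ^+ 2 * n%:R.
  by near: n; apply: large; rewrite mulr_gt0 ?exprn_gt0.
have nb2 : 8 < beta ^+ 2 * eps ^+ 4 * n%:R.
  by near: n; apply: large; rewrite mulr_gt0 ?exprn_gt0.
have /andP[P0 P1] :=
  rainbow_cycle_rate halpha beta0 beta1 betaa eps0 eps1 (hc n) n4 na ne nb nb2.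
rewrite ger0_norm //; apply: le_lt_trans P1 _; rewrite ltr_pdivrMr //.
by near: n; apply: large.
Unshelve. all: by end_near.
Qed.
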